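(* In a platypus of order $n$, any two (distinct) vertices of degree $n - 4$ are adjacent.
   Context: Graphs are finite and simple, with at least three vertices. A graph is hamiltonian (traceable) if it contains a spanning cycle (spanning path). A platypus is a non-hamiltonian graph $G$ such that for every vertex $v$ of $G$ the vertex-deleted subgraph $G-v$ is traceable. The order of a graph is its number of vertices. *)

(* Defs.v *)
From mathcomp Require Import all_boot.
Set Implicit Arguments.
Unset Strict Implicit.
Unset Printing Implicit Defensive.

(* A finite simple graph is a finType of vertices with a symmetric irreflexive
   adjacency relation [e]. *)
Definition simple_graph (T : finType) (e : rel T) : Prop :=
  symmetric e /\ irreflexive e.

Definition degree (T : finType) (e : rel T) (x : T) : nat :=
  #|[set y | e x y]|.

(* [2 < size c] is needed: [cycle] alone also accepts the empty sequence and
   going back and forth along a single edge. *)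
Definition hamiltonian (T : finType) (e : rel T) : Prop :=
  exists c : seq T,
    [/\ 2 < size c, uniq c, cycle e c & forall x : T, x \in c].

Definition traceable (T : finType) (e : rel T) : Prop :=
  exists (x : T) (p : seq T),
    [/\ uniq (x :: p), path e x p & forall y : T, y \in x :: p].

Definition del_vertex (T : finType) (e : rel T) (v : T) : rel {x : T | x != v} :=
  fun x y => e (val x) (val y).

Definition platypus (T : finType) (e : rel T) : Prop :=
  ~ hamiltonian e /\ forall v : T, traceable (@del_vertex T e v).

(* Main.v *)
(* In a platypus all degrees are at least 2, and two vertices of degree 2 have no
   common neighbor c: both would be ends of every spanning path of G - c, which c
   would close to a hamiltonian cycle. Hence no vertex v has only nonneighbors of
   degree 2: rotating a spanning path of G - v at both ends makes its ends
   neighbors of v. By Bondy and Chvatal, joining nonadjacent vertices of degree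
   sum at least n preserves platypuses; joining v of degree at least n - 3 to its
   nonneighbors of degree at least 3 therefore shows that the maximum degree is at
   most n - 4. If u, v are nonadjacent of degree n - 4, then G + uv has a vertex of
   degree n - 3, so it is hamiltonian and G has a spanning path from u to v.
   Counting crossing chords leaves only n = 6 and n = 7, where the bound on the
   maximum degree determines the chords at u and v. *)
Require Import Defs.
From mathcomp Require Import all_boot zify.

Set Implicit Arguments.
Unset Strict Implicit.
Unset Printing Implicit Defensive.

(** * Spanning paths with prescribed ends *)

(** With the vertex set as a predicate [A], spanning paths of G ([predT]) and of G - v ([predC1 v])
    are treated alike, without the subtype of [del_vertex]. *)
Definition hpath (T : finType) (e : rel T) (A : pred T) (x z : T) : Prop :=
  exists p, [/\ path e x p, uniq (x :: p), last x p = z & x :: p =i A].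

Definition add_edge (T : finType) (e : rel T) (u v : T) : rel T :=
  fun x y => [|| e x y, (x == u) && (y == v) | (x == v) && (y == u)].

Lemma rev_cons_belast (T : Type) (x : T) (p : seq T) :
  rev (x :: p) = last x p :: rev (belast x p).
Proof. by rewrite lastI rev_rcons. Qed.

Lemma last_rev_belast (T : Type) (x : T) (p : seq T) :
  last (last x p) (rev (belast x p)) = x.
Proof. by case: p => //= y p; rewrite rev_cons last_rcons. Qed.

Lemma sym_rev_path (T : Type) (e : rel T) (x : T) (p : seq T) :
  symmetric e -> path e (last x p) (rev (belast x p)) = path e x p.
Proof. by move=> sym; rewrite rev_path; apply: eq_path => y z; rewrite sym. Qed.

Lemma hpath_sym (T : finType) (e : rel T) (A : pred T) (x z : T) :
  symmetric e -> hpath e A x z -> hpath e A z x.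
Proof.
move=> sym [p [pathp uniqp <- memp]]; exists (rev (belast x p)).
split; rewrite ?sym_rev_path ?last_rev_belast -?rev_cons_belast ?rev_uniq //.
by move=> y; rewrite mem_rev memp.
Qed.

(** Posa rotation: the initial segment is reversed and rejoined through the chord from [x] to [c],
    so that its last vertex becomes the new start. *)
Lemma splice_rev (T : Type) (e : rel T) (x c : T) (p q : seq T) :
  symmetric e -> path e x (p ++ c :: q) -> e x c ->
  path e (last x p) (rev (belast x p) ++ c :: q).
Proof.
move=> sym; rewrite !cat_path /= => /and3P[pathp _ pathq] exc.
by rewrite sym_rev_path // pathp last_rev_belast exc.
Qed.

Lemma leq_degree (T : finType) (e : rel T) (x : T) (s : seq T) :
  uniq s -> all (e x) s -> size s <= degree e x.
Proof.
move=> uniqs /allP alls; rewrite /degree -(card_uniqP uniqs).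
by apply/subset_leq_card/subsetP => y /alls; rewrite inE.
Qed.

Lemma degree_count (T : finType) (e : rel T) (x : T) (s : seq T) :
  uniq s -> (forall y, y \in s) -> degree e x = count (e x) s.
Proof.
move=> uniqs mems; rewrite -size_filter /degree.
rewrite -(card_uniqP (filter_uniq _ uniqs)).
by apply: eq_card => y; rewrite inE mem_filter mems andbT.
Qed.

Lemma card_size (T : finType) (s : seq T) :
  uniq s -> (forall y, y \in s) -> #|T| = size s.
Proof. by move=> /card_uniqP <- mems; apply: eq_card => y; rewrite mems. Qed.

(** * Vertices of small degree in a platypus *)

Lemma hpath_close (T : finType) (e : rel T) (v x z : T) :
  2 < #|T| -> symmetric e -> hpath e (predC1 v) x z -> e v x -> e v z ->
  hamiltonian e.
Proof.
move=> T3 sym [p [pathp uniqp lastp memp]] evx evz.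
have uniqc : uniq (v :: x :: p) by rewrite cons_uniq memp inE eqxx.
have memc y : y \in v :: x :: p by rewrite inE memp inE orbN.
exists (v :: x :: p); split=> //; first by rewrite -card_size.
by rewrite /= rcons_path pathp lastp evx sym.
Qed.

Lemma platypus_hpath (T : finType) (e : rel T) (v : T) :
  platypus e -> exists x z, hpath e (predC1 v) x z.
Proof.
move=> [_ /(_ v)[x [p [uniqp pathp memp]]]].
exists (val x), (last (val x) (map val p)), (map val p); split=> //.
- by rewrite path_map.
- by rewrite -map_cons (map_inj_uniq val_inj).
move=> y; rewrite [RHS]inE /= -map_cons.
apply/idP/idP => [/mapP[t _ ->]|yv]; first exact: (valP t).
by apply/mapP; exists (Sub y yv).
Qed.

(** A spanning path of G - w has at least two vertices, so it provides a neighbor of [a] on it. *)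
Lemma platypus_neighbor (T : finType) (e : rel T) (a w : T) :
  2 < #|T| -> symmetric e -> platypus e -> a != w -> exists2 y, e a y & y != w.
Proof.
move=> T3 sym plat aw.
have [x [z [p [pathp uniqp _ memp]]]] := platypus_hpath w plat.
have sizep : 1 < size (x :: p).
  rewrite -(card_uniqP uniqp) (eq_card memp).
  by rewrite cardC1; lia.
have : a \in x :: p by rewrite memp.
case: p => // y p in pathp uniqp memp sizep *.
rewrite inE => /orP[/eqP->|ap].
  by exists y; [case/andP: pathp | have := memp y; rewrite !inE eqxx orbT].
case/splitPr: ap pathp memp => p1 p2; rewrite cat_path /= => /and3P[_ ea _] memp.
exists (last x p1); first by rewrite sym.
by have := memp (last x p1); rewrite -cat_cons mem_cat mem_last.
Qed.

Lemma platypus_degree_gt1 (T : finType) (e : rel T) (a : T) :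
  2 < #|T| -> simple_graph e -> platypus e -> 1 < degree e a.
Proof.
move=> T3 [sym irr] plat.
have [w aw] : exists w, a != w.
  apply/existsP; apply: contraLR T3 => /existsPn all_a.
  rewrite -leqNgt (leq_trans _ (isT : 1 <= 2)) //; apply/card_le1_eqP => x y _ _.
  by have := all_a x; have := all_a y; rewrite !negbK => /eqP <- /eqP <-.
have [y ay _] := platypus_neighbor T3 sym plat aw.
have [|z az zy] := platypus_neighbor T3 sym plat (_ : a != y).
  by apply: contraTneq ay => <-; rewrite irr.
by apply: (@leq_degree _ _ _ [:: z; y]); rewrite /= ?inE ?zy ?az ?ay.
Qed.

(* A vertex of degree at most 2 adjacent to c is an end of every spanning path
   of G - c. *)
Lemma hpath_end (T : finType) (e : rel T) (a c x z : T) :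
  symmetric e -> hpath e (predC1 c) x z -> e a c -> a != c -> degree e a <= 2 ->
  a = x \/ a = z.
Proof.
move=> sym [p [pathp uniqp lastp memp]] eac ac deg_a.
have : a \in x :: p by rewrite memp.
rewrite inE => /orP[/eqP|ap]; first by left.
right; rewrite -{}lastp.
case/splitPr: ap pathp uniqp memp => p1 [|y p2] pathp uniqp memp.
  by rewrite last_cat.
move: pathp; rewrite cat_path /= => /and4P[_ ea ay _].
have/negP[] : ~~ (2 < degree e a) by rewrite -leqNgt.
apply: (@leq_degree _ _ _ [:: last x p1; y; c]); last by rewrite /= sym ea ay eac.
have l1 : last x p1 \in x :: p1 by apply: mem_last.
have yc : y != c.
  by have := memp y; rewrite -cat_cons mem_cat !inE eqxx !orbT => <-.
have lc : last x p1 != c.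
  by have := memp (last x p1); rewrite -cat_cons mem_cat l1 => /esym.
rewrite /= !inE negb_or yc lc !andbT.
move: uniqp; rewrite -cat_cons cat_uniq.
case/and3P=> _ /hasPn/(_ y) + _; rewrite !inE eqxx !orbT => /(_ isT).
by apply: contraNneq => <-; rewrite -in_cons.
Qed.

Lemma platypus_no_common_neighbor (T : finType) (e : rel T) (a b c : T) :
  2 < #|T| -> simple_graph e -> platypus e -> a != b ->
  degree e a <= 2 -> degree e b <= 2 -> e a c -> e b c -> False.
Proof.
move=> T3 [sym irr] plat ab deg_a deg_b ac bc.
have [x [z pxz]] := platypus_hpath c plat.
have neqc w : e w c -> w != c by apply: contraTneq => ->; rewrite irr.
have endsa := hpath_end sym pxz ac (neqc _ ac) deg_a.
have endsb := hpath_end sym pxz bc (neqc _ bc) deg_b.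
case: plat => nonham _; apply: nonham.
rewrite sym in ac; rewrite sym in bc.
case: endsa endsb => [ax|az] [bx|bz]; subst; rewrite ?eqxx // in ab *.
  exact: (hpath_close T3 sym pxz ac bc).
exact: (hpath_close T3 sym pxz bc ac).
Qed.

(* Turn the path x ... d c ... z around the edge x c: the new start d shares
   the neighbor c with x, so it cannot have degree 2. *)
Lemma hpath_rotate (T : finType) (e : rel T) (v x z : T) :
  2 < #|T| -> simple_graph e -> platypus e ->
  (forall w, w != v -> ~~ e v w -> degree e w <= 2) ->
  hpath e (predC1 v) x z -> exists2 d, e v d & hpath e (predC1 v) d z.
Proof.
move=> T3 graph plat deg2 pxz; have [sym irr] := graph.
have [evx|nvx] := boolP (e v x); first by exists x.
case: pxz => p [pathp uniqp lastp memp].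
have xv : x != v by have := memp x; rewrite inE eqxx => /esym.
case: p => [|y q] in pathp uniqp lastp memp *.
  have [t xt _] := platypus_neighbor T3 sym plat xv.
  have := memp t; rewrite inE [in RHS]inE /=; case: eqVneq => [tx|_ /esym/eqP tv].
    by rewrite tx irr in xt.
  by rewrite sym -tv xt in nvx.
have xy : x != y by move: uniqp; rewrite /= inE negb_or => /andP[/andP[]].
(* The edge from [x] to [c] is a chord, as [y] is the successor of [x]; since [x] is not adjacent to
   [v], [c] lies beyond [y] on the path. *)
have [c xc cy] := platypus_neighbor T3 sym plat xy.
have : c \in x :: y :: q.
  by rewrite memp inE /=; apply: contraNneq nvx => <-; rewrite sym.
rewrite !inE (negPf cy) /=.
have -> /= : (c == x) = false by apply: contraTF xc => /eqP ->; rewrite irr.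
move=> cq; case/splitPr: cq pathp uniqp lastp memp => q1 q2.
rewrite -[y :: q1 ++ _]/((y :: q1) ++ _); set p1 := y :: q1.
move=> pathp uniqp lastp memp.
have uniqr : uniq (rev (x :: p1) ++ c :: q2).
  by rewrite (perm_uniq (_ : perm_eq _ ((x :: p1) ++ c :: q2))) // perm_cat2r perm_rev.
have memr w : (w \in rev (x :: p1) ++ c :: q2) = (w != v).
  by rewrite mem_cat mem_rev -mem_cat memp.
have dc : e (last x p1) c by move: pathp; rewrite cat_path => /= /and3P[].
exists (last x p1); last first.
  exists (rev (belast x p1) ++ c :: q2).
  rewrite -cat_cons -rev_cons_belast; split=> //; first exact: splice_rev.
  by rewrite -lastp !last_cat.
apply: contraT => nvd; exfalso.
have dv : last x p1 != v by rewrite -memr mem_cat mem_rev mem_last.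
apply: (platypus_no_common_neighbor T3 graph plat _ _ _ xc dc); try exact: deg2.
move: uniqp; rewrite cons_uniq mem_cat negb_or -andbA => /and3P[+ _ _].
by apply: contraNneq => ->; rewrite /= mem_last.
Qed.

Lemma platypus_low_degree_nonneighbors (T : finType) (e : rel T) (v : T) :
  2 < #|T| -> simple_graph e -> platypus e ->
  (forall w, w != v -> ~~ e v w -> degree e w <= 2) -> False.
Proof.
move=> T3 graph plat deg2; have [sym irr] := graph.
have [x [z pxz]] := platypus_hpath v plat.
have [x' vx' px'z] := hpath_rotate T3 graph plat deg2 pxz.
(* Rotating the reversed path leaves the end [x'], already adjacent to [v], in place. *)
have [z' vz' pz'x'] := hpath_rotate T3 graph plat deg2 (hpath_sym sym px'z).
by case: plat => nonham _; apply/nonham/(hpath_close T3 sym pz'x').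
Qed.

(** * Crossing chords and added edges *)

(** Each entry of [p] is paired with its predecessor; more than [size p] hits over [size p] pairs
    put two hits in one pair. *)
Lemma count_shift_pigeonhole (T : Type) (a b : pred T) (x : T) (p : seq T) :
  size p < count a p + count b (belast x p) ->
  exists p1 y p2, [/\ p = p1 ++ y :: p2, a y & b (last x p1)].
Proof.
elim: p x => //= y p IHp x; case ay: (a y); case bx: (b x) => /= lt.
- by exists [::], y, p.
all: have [|p1 [t [p2 [-> at_ bl]]]] := IHp y; first by lia.
all: by exists (y :: p1), t, p2.
Qed.

(** Ore's argument: otherwise some path edge l y has y adjacent to [u] and l adjacent to [v], and u
    ... l v ... y is a spanning cycle. *)
Lemma hpath_cross (T : finType) (e : rel T) (u v : T) :
  2 < #|T| -> simple_graph e -> ~ hamiltonian e -> hpath e predT u v ->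
  degree e u + degree e v < #|T|.
Proof.
move=> T3 [sym irr] nonham [p [pathp uniqp lastp memp]].
have memT y : y \in u :: p by rewrite memp.
rewrite ltnNge; apply/negP => le_deg; apply: nonham.
have [|p1 [y [p2 [def_p uy vl]]]] := @count_shift_pigeonhole _ (e u) (e v) u p.
  move: le_deg; rewrite !(degree_count _ _ uniqp memT) (card_size uniqp memT).
  by rewrite [X in _ + count _ X]lastI /= -cats1 count_cat /= lastp !irr; lia.
exists (u :: p1 ++ rev (y :: p2)).
have perm_c : perm_eq (u :: p1 ++ rev (y :: p2)) (u :: p).
  by rewrite def_p perm_cons perm_cat2l perm_rev.
split.
- by rewrite (perm_size perm_c) -(card_size uniqp memT).
- by rewrite (perm_uniq perm_c).
- move: pathp lastp; rewrite def_p last_cat /= => + lastp.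
  rewrite rcons_path !cat_path rev_cons_belast /= => /and3P[-> _ pathp2].
  by rewrite sym_rev_path // pathp2 last_cat /= last_rev_belast lastp sym vl sym uy.
by move=> w; rewrite (perm_mem perm_c).
Qed.

Lemma add_edge_graph (T : finType) (e : rel T) (u v : T) :
  simple_graph e -> u != v -> simple_graph (add_edge e u v).
Proof.
move=> [sym irr] uv; split=> [x y|x]; rewrite /add_edge.
  by rewrite sym; congr (_ || _); rewrite orbC ![(y == _) && _]andbC.
rewrite irr /=; apply/norP; split; apply: contraNN uv.
  by case/andP=> /eqP <- /eqP <-.
by case/andP=> /eqP <- /eqP <-.
Qed.

Lemma add_edge_degree (T : finType) (e : rel T) (u v : T) :
  ~~ e u v -> degree e u < degree (add_edge e u v) u.
Proof.
move=> nuv; apply/proper_card/properP; split.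
  by apply/subsetP => y; rewrite !inE /add_edge => ->.
by exists v; rewrite !inE /add_edge ?eqxx ?orbT.
Qed.

(** Start the cycle at [u]: only its two edges at [u] can be new, and dropping a new one leaves a
    spanning path between [u] and [v]. *)
Lemma add_edge_hamiltonian (T : finType) (e : rel T) (u v : T) :
  simple_graph e -> u != v -> hamiltonian (add_edge e u v) ->
  hamiltonian e \/ hpath e predT u v.
Proof.
move=> [sym irr] uv [c [size_c uniq_c cycle_c mem_c]].
have [i q def_q] := rot_to (mem_c u).
have size_q : size c = size (u :: q) by rewrite -def_q size_rot.
have uniq_q : uniq (u :: q) by rewrite -def_q rot_uniq.
have mem_q w : w \in u :: q by rewrite -def_q mem_rot.
rewrite -(rot_cycle i) def_q in cycle_c.
case: q => [|h q] in cycle_c size_q uniq_q mem_q {def_q}; first by rewrite size_q in size_c.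
have nu w : w \in h :: q -> (w == u) = false.
  by move=> wq; apply: contraTF uniq_q => /eqP <-; rewrite /= wq.
have stay x y : x \in h :: q -> y \in h :: q -> add_edge e u v x y = e x y.
  by move=> /nu xu /nu yu; rewrite /add_edge xu yu andbF !orbF.
have pathq : path e h q.
  move: cycle_c; rewrite /= rcons_path => /and3P[_ + _].
  by rewrite (eq_in_path (P := [in h :: q]) stay) //; apply/allP.
have hu : (h == u) = false by apply: nu; rewrite inE eqxx.
have lu : (last h q == u) = false by apply: nu; rewrite mem_last.
move: cycle_c; rewrite /= rcons_path /= => /and3P[+ _ +].
rewrite /add_edge !eqxx hu lu andbF orbF /= => uh lu'.
have [euh|nuh] := boolP (e u h); have [elu|nlu] := boolP (e (last h q) u).
- left; exists (u :: h :: q); split=> //; first by rewrite -size_q.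
  by rewrite /= rcons_path euh pathq elu.
- right; exists (h :: q); split=> //=; first by rewrite euh.
    by move: lu'; rewrite (negPf nlu) andbT /= => /eqP.
- right; apply: hpath_sym => //; exists (rcons q u).
  move: uh; rewrite (negPf nuh) /= => /eqP <-.
  split; rewrite ?rcons_path ?pathq ?elu ?last_rcons //.
    by rewrite -[_ && _]/(uniq (rcons (h :: q) u)) rcons_uniq.
  by move=> w; rewrite -rcons_cons mem_rcons mem_q.
(* Two new edges at [u] would make [v] both the first and the last of the other vertices, of which
   there are at least two. *)
- move: uh lu'; rewrite (negPf nuh) (negPf nlu) andbT /= => /eqP hv /eqP lv.
  case: q => [|t q] in size_q uniq_q lv {mem_q nu stay pathq nlu lu}.
    by rewrite size_q in size_c.
  by move: uniq_q; rewrite /= hv -lv /= mem_last andbF.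
Qed.

Lemma add_edge_traceable (T : finType) (e : rel T) (u v w : T) :
  traceable (@del_vertex T e w) -> traceable (@del_vertex T (add_edge e u v) w).
Proof.
move=> [x [p [uniqp pathp memp]]]; exists x, p; split=> //.
by apply: sub_path pathp => y z; rewrite /del_vertex /add_edge => ->.
Qed.

Lemma add_edge_platypus (T : finType) (e : rel T) (u v : T) :
  2 < #|T| -> simple_graph e -> platypus e -> u != v ->
  #|T| <= degree e u + degree e v -> platypus (add_edge e u v).
Proof.
move=> T3 graph [nonham trace] uv le_deg; split.
  case/(add_edge_hamiltonian graph uv) => // puv.
  by have := hpath_cross T3 graph nonham puv; rewrite ltnNge le_deg.
by move=> w; apply: add_edge_traceable.
Qed.

(** * The degree bound and the two small orders *)

(** Induction on n minus the degree of [v], over all graphs: at degree at least n - 3, joining [v]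
    to a nonneighbor of degree at least 3 gives a platypus in which [v] has larger degree. *)
Lemma platypus_max_degree (T : finType) (e : rel T) (v : T) :
  2 < #|T| -> simple_graph e -> platypus e -> degree e v + 3 < #|T|.
Proof.
move=> T3; have [k] := ubnP (#|T| - degree e v).
elim: k e => // k IHk e lt_k graph plat.
rewrite ltnNge; apply/negP => deg_v.
apply: (platypus_low_degree_nonneighbors T3 graph plat (v := v)) => w wv nvw.
rewrite leqNgt; apply/negP => deg_w.
have vw : v != w by rewrite eq_sym.
have graph' := add_edge_graph graph vw.
have plat' : platypus (add_edge e v w) by apply: add_edge_platypus => //; lia.
have lt_deg := add_edge_degree nvw.
(* This makes the truncated subtraction in the induction measure strictly decrease. *)
have deg_le : degree (add_edge e v w) v <= #|T| by apply: max_card.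
suff : degree (add_edge e v w) v + 3 < #|T| by lia.
by apply: IHk => //; lia.
Qed.

(* Number the path 1, ..., 7 with u = 1 and v = 7. Crossing chords and the
   degree bound leave only the chords 1-5, 1-6, 7-2, 7-3, which give the cycle
   1 2 7 3 4 5 6. *)
Lemma hpath_order7 (T : finType) (e : rel T) (u v : T) :
  simple_graph e -> #|T| = 7 -> (forall w, degree e w <= 3) ->
  ~~ e u v -> degree e u = 3 -> degree e v = 3 -> hpath e predT u v ->
  hamiltonian e.
Proof.
move=> [sym irr] T7 deg3 nuv deg_u deg_v [p [pathp uniqp lastp memp]].
have memT y : y \in u :: p by rewrite memp.
have ham c : size c = 7 -> all [in c] (u :: p) -> cycle e c -> hamiltonian e.
  move=> size_c /allP subc cycle_c; exists c; split=> //; first by rewrite size_c.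
    apply: (leq_size_uniq uniqp) => //.
    by rewrite size_c -T7 (card_size uniqp memT).
  by move=> y; apply: subc.
have deg y m : all (e y) (mask m (u :: p)) -> size (mask m (u :: p)) = 4 -> False.
  move=> nbrs size4; have := leq_degree (mask_uniq uniqp m) nbrs.
  by rewrite size4 ltnNge deg3.
have := degree_count e u uniqp memT; have := degree_count e v uniqp memT.
have := card_size uniqp memT; rewrite T7 deg_u deg_v.
case: p => [|b [|c [|d [|f [|g [|w []]]]]]] // in pathp lastp ham deg {uniqp memp memT} *.
move=> _; move: lastp pathp => /= wv; subst w.
move=> /and5P[ub bc cd df /and3P[fg gv _]].
rewrite !irr (negPf nuv) ![e v _]sym (negPf nuv) ub gv /=.
case uc: (e u c); case ud: (e u d); case uf: (e u f); case ug: (e u g);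
  case bv: (e b v); case cv: (e c v); case dv: (e d v); case fv: (e f v) => //= _ _.
(* One of [c], [d], [f] adjacent to both [u] and [v] would have degree at least 4. *)
all: try by case: (deg c [:: true; true; false; true; false; false; true]);
  rewrite //= (sym c u) (sym c b) uc bc cd cv.
all: try by case: (deg d [:: true; false; true; false; true; false; true]);
  rewrite //= (sym d u) (sym d c) ud cd df dv.
all: try by case: (deg f [:: true; false; false; true; false; true; true]);
  rewrite //= (sym f u) (sym f d) uf df fg fv.
(* Chords crossing over an inner path edge close a spanning cycle; there is one block for each of
   the four inner edges. *)
all: try by apply: (ham [:: u; c; d; f; g; v; b]);
  rewrite /= ?inE ?eqxx ?orbT // uc cd df fg gv sym bv sym ub.
all: try by apply: (ham [:: u; d; f; g; v; c; b]);
  rewrite /= ?inE ?eqxx ?orbT // ud df fg gv (sym v c) cv (sym c b) bc (sym b u) ub.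
all: try by apply: (ham [:: u; f; g; v; d; c; b]);
  rewrite /= ?inE ?eqxx ?orbT // uf fg gv (sym v d) dv (sym d c) cd (sym c b) bc (sym b u) ub.
all: try by apply: (ham [:: u; g; v; f; d; c; b]);
  rewrite /= ?inE ?eqxx ?orbT // ug gv (sym v f) fv (sym f d) df (sym d c) cd (sym c b) bc (sym b u) ub.
by apply: (ham [:: u; b; v; c; d; f; g]);
  rewrite /= ?inE ?eqxx ?orbT // ub bv (sym v c) cv cd df fg (sym g u) ug.
Qed.

(* An inner vertex of the path adjacent to u through a chord would have
   degree 3. *)
Lemma hpath_order6 (T : finType) (e : rel T) (u v : T) :
  simple_graph e -> #|T| = 6 -> (forall w, degree e w <= 2) ->
  ~~ e u v -> 1 < degree e u -> hpath e predT u v -> False.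
Proof.
move=> [sym irr] T6 deg2 nuv deg_u [p [pathp uniqp lastp memp]].
have memT y : y \in u :: p by rewrite memp.
have deg y m : all (e y) (mask m (u :: p)) -> size (mask m (u :: p)) = 3 -> False.
  move=> nbrs size3; have := leq_degree (mask_uniq uniqp m) nbrs.
  by rewrite size3 ltnNge deg2.
have := degree_count e u uniqp memT; have := card_size uniqp memT; rewrite T6.
case: p => [|b [|c [|d [|f [|w []]]]]] // in pathp lastp deg {uniqp memp memT} *.
move=> _; move: lastp pathp => /= wv; subst w.
move=> /and5P[ub bc cd df /andP[fv _]].
rewrite irr (negPf nuv) ub.
case uc: (e u c).
  by case: (deg c [:: true; true; false; true]); rewrite //= (sym c u) (sym c b) uc bc cd.
case ud: (e u d).
  by case: (deg d [:: true; false; true; false; true]); rewrite //= (sym d u) (sym d c) ud cd df.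
case uf: (e u f).
  by case: (deg f [:: true; false; false; true; false; true]);
    rewrite //= (sym f u) (sym f d) uf df fv.
by move=> /= deg1; rewrite deg1 in deg_u.
Qed.

Theorem theorem13 (T : finType) (e : rel T) (n : nat)
    (graph_e : simple_graph e) (order_n : #|T| = n) (n_ge3 : 3 <= n)
    (plat_e : platypus e) (u v : T) (neq_uv : u <> v)
    (deg_u : degree e u + 4 = n) (deg_v : degree e v + 4 = n) :
  e u v.
Proof.
apply: contraT => nuv; exfalso; subst n.
have uv : u != v by apply/eqP.
have [nonham trace] := plat_e.
have maxdeg w := platypus_max_degree w n_ge3 graph_e plat_e.
have deg_u2 := platypus_degree_gt1 u n_ge3 graph_e plat_e.
have graph' := add_edge_graph graph_e uv.
(* In G + uv the degree of [u] is at least n - 3, above the bound for a platypus. *)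
suff plat' : platypus (add_edge e u v).
  have := platypus_max_degree u n_ge3 graph' plat'.
  by have := add_edge_degree nuv; lia.
split=> [/(add_edge_hamiltonian graph_e uv)[//|puv] | w]; last first.
  exact: add_edge_traceable.
have lt_deg := hpath_cross n_ge3 graph_e nonham puv.
(* The degree sum 2n - 8 is less than n, so n is at most 7; degree at least 2 at [u] makes n at
   least 6. *)
have [T6|T7] : #|T| = 6 \/ #|T| = 7 by lia.
  apply: (hpath_order6 graph_e T6 _ nuv deg_u2 puv) => w.
  by have := maxdeg w; lia.
apply/nonham/(hpath_order7 graph_e T7 _ nuv _ _ puv) => [w||]; try lia.
by have := maxdeg w; lia.
Qed.
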